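(* A quasi-metric space $(X,d)$ is a $\mathbb{J}$-algebra if and only if $(X,d)$ is standard and the partially ordered set $(\mathrm{B}X,\sqsubseteq)$ of formal balls of $(X,d)$ is a local dcpo.
   Context: A quasi-metric space is a set $X$ with a map $d\colon X\times X\to[0,\infty]$ such that $d(x,x)=0$, $d(x,y)+d(y,z)\ge d(x,z)$, and $d(x,y)=d(y,x)=0$ implies $x=y$. Here $a\ominus b=\max\{0,a-b\}$ for $a,b\in[0,\infty]$, with $a\ominus\infty=0$ for all $a$ (including $a=\infty$) and $\infty\ominus b=\infty$ for $b<\infty$. All orders between numbers are the usual ones. Formal balls: a formal ball of $(X,d)$ is a pair $(x,r)\in X\times[0,\infty)$; the set $\mathrm{B}X$ of formal balls is partially ordered by $(x,r)\sqsubseteq(y,s)$ iff $d(x,y)\le r-s$. A directed subset of $\mathrm{B}X$ is written as a net $\{(x_i,r_i)\}_{i\in D}$ indexed by itself, with $i\le j$ iff $(x_i,r_i)\sqsubseteq(x_j,r_j)$. Joins are least upper bounds. Forward Cauchy nets and Yoneda limits: a net $\{x_i\}_{i\in D}$ in $X$ is forward Cauchy if $\inf_{i}\sup_{k\ge j\ge i}d(x_j,x_k)=0$; $x\in X$ is a Yoneda limit of it if $d(x,y)=\inf_{i}\sup_{j\ge i}d(x_j,y)$ for all $y\in X$. (For a directed set $\{(x_i,r_i)\}_{i\in D}$ of $\mathrm{B}X$, the net $\{x_i\}_{i\in D}$ is forward Cauchy.) Standard: $(X,d)$ is standard if whenever a directed set $\{(x_i,r_i)\}_{i\in D}$ of $\mathrm{B}X$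 has a join, the forward Cauchy net $\{x_i\}_{i\in D}$ has a Yoneda limit. Local dcpo: a partially ordered set in which each directed set with an upper bound has a join. Weights: a weight of $(X,d)$ is a map $\phi\colon X\to[0,\infty]$ with $\phi(y)+d(x,y)\ge\phi(x)$ for all $x,y$. $\mathcal{P}X$ is the set of weights with the quasi-metric $\rho_X(\phi,\psi)=\sup_{x\in X}\psi(x)\ominus\phi(x)$. A weight $\phi$ is an ideal if $\inf_{x}\phi(x)=0$ and $\rho_X(\phi,\lambda\wedge\mu)=\min\{\rho_X(\phi,\lambda),\rho_X(\phi,\mu)\}$ for all $\lambda,\mu\in\mathcal{P}X$, where $\lambda\wedge\mu$ is the pointwise minimum. A weight $\phi$ is bounded if $\inf_{x\in X}\rho_X(\phi,d(-,x))<\infty$, i.e. there are $a\in X$, $r<\infty$ with $r+\phi\ge d(-,a)$ pointwise. A bounded ideal is a weight that is both bounded and an ideal; $\mathcal{J}X\subseteq\mathcal{P}X$ is the subspace of bounded ideals. An element $b\in X$ is a colimit of a weight $\phi$ if $d(b,x)=\rho_X(\phi,d(-,x))$ for all $x\in X$. $\mathbb{J}=(\mathcal{J},\mathsf{m},\mathsf{y})$ is the bounded ideal monad on the category of quasi-metric spaces and non-expansive maps (maps $f$ with $d_X(x,y)\ge d_Y(f(x),f(y))$): $\mathcal{J}f(\phi)(y)=\inf_{x}(\phi(x)+d_Y(y,f(x)))$, unit $\mathsf{y}_X(x)=d(-,x)$, multiplication $\mathsf{m}_X(\Phi)=\inf_{\phi\in\mathcal{J}X}(\Phi(\phi)+\phi)$.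 It is a Kock-Zöberlein (lax-idempotent) monad, so $(X,d)$ is a $\mathbb{J}$-algebra precisely when every bounded ideal of $(X,d)$ has a colimit, equivalently, when $\mathsf{y}_X\colon X\to\mathcal{J}X$ has a left adjoint; this may be taken as the definition of $\mathbb{J}$-algebra. *)

(* Defs.v *)
From HB Require Import structures.
From mathcomp Require Import all_boot all_order all_algebra.
From mathcomp Require Import mathcomp_extra boolp classical_sets reals.
From mathcomp Require Import interval_inference constructive_ereal ereal.

Set Implicit Arguments.
Unset Strict Implicit.
Unset Printing Implicit Defensive.

Import Order.TTheory GRing.Theory Num.Theory.
Local Open Scope classical_set_scope.
Local Open Scope ring_scope.
Local Open Scope ereal_scope.

(* [0, oo] is the nonnegative part of \bar R. *)

HB.mixin Record isQuasiMetric (R : realType) (X : Type) := {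
  qdist : X -> X -> \bar R;
  qdist_ge0 : forall x y, 0 <= qdist x y;
  qdistxx : forall x, qdist x x = 0;
  qdist_triangle : forall x y z, qdist x z <= qdist x y + qdist y z;
  qdist_eq0 : forall x y, qdist x y = 0 -> qdist y x = 0 -> x = y }.

#[short(type="quasiMetricType")]
HB.structure Definition QuasiMetric (R : realType) := {X of isQuasiMetric R X}.

(* The supremum in [0, oo]: unlike ereal_sup, it sends the empty set to 0. *)
Definition nnsup (R : realType) (A : set (\bar R)) : \bar R :=
  ereal_sup (0 |` A).

(* In \bar R, a - +oo = -oo for every a, so esubn a +oo = 0 even for a = +oo. *)
Definition esubn (R : realType) (a b : \bar R) : \bar R := maxe 0 (a - b).

Section Order.
Context {disp : Order.disp_t} {T : porderType disp}.

Definition directed (A : set T) :=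
  A !=set0 /\
  forall a b, A a -> A b -> exists2 c, A c & (a <= c)%O /\ (b <= c)%O.

Definition has_join (A : set T) := supremums A !=set0.

Definition local_dcpo :=
  forall A : set T, directed A -> has_ubound A -> has_join A.

End Order.
Arguments local_dcpo {disp} T.

Section QuasiMetric.
Context {R : realType} {X : quasiMetricType R}.
Implicit Types phi psi : X -> \bar R.

(* In the next two definitions a net in X is x : T -> X restricted to a
   directed subset D of T, ordered as in T. *)
Definition forward_cauchy {disp} {T : porderType disp}
    (D : set T) (x : T -> X) :=
  ereal_inf [set nnsup [set qdist (x jk.1) (x jk.2) |
      jk in [set jk : T * T |
        [/\ D jk.1, D jk.2, (i <= jk.1)%O & (jk.1 <= jk.2)%O]]]
    | i in D] = 0.

Definition yoneda_limit {disp} {T : porderType disp}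
    (D : set T) (x : T -> X) (a : X) :=
  forall y, qdist a y =
    ereal_inf [set nnsup [set qdist (x j) y | j in [set j | D j /\ (i <= j)%O]]
      | i in D].

Definition weight phi :=
  (forall x, 0 <= phi x) /\ (forall x y, phi x <= phi y + qdist x y).

Definition rho phi psi : \bar R :=
  nnsup (range (fun x => esubn (psi x) (phi x))).

Definition yoneda (a : X) : X -> \bar R := fun x => qdist x a.

Definition ideal phi :=
  [/\ weight phi,
      ereal_inf (range phi) = 0 &
      forall la mu, weight la -> weight mu ->
        rho phi (fun x => mine (la x) (mu x)) = mine (rho phi la) (rho phi mu)].

Definition bounded_weight phi :=
  weight phi /\ ereal_inf (range (fun a => rho phi (yoneda a))) < +oo.

Definition bounded_ideal phi := bounded_weight phi /\ ideal phi.

Definition colimit phi (b : X) := forall x, qdist b x = rho phi (yoneda x).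

End QuasiMetric.

(* Algebras of the bounded ideal monad.  The monad is lax-idempotent, so being
   an algebra is a property: the unit yoneda : X -> JX has a left adjoint,
   i.e. every bounded ideal has a colimit. *)
Definition J_algebra {R : realType} (X : quasiMetricType R) :=
  forall phi : X -> \bar R, bounded_ideal phi -> exists b, colimit phi b.

Definition formal_ball {R : realType} (X : quasiMetricType R) : Type :=
  (X * {nonneg R})%type.

Fact formal_ball_display : Order.disp_t. Proof. exact: Order.Disp. Qed.

Section FormalBall.
Context {R : realType} {X : quasiMetricType R}.
Local Notation B := (formal_ball X).

Definition center (b : B) : X := b.1.
Definition radius (b : B) : R := b.2%:num.

Definition ball_le (a b : B) : bool :=
  qdist (center a) (center b) <= (radius a - radius b)%:E.

Lemma ball_le_refl : reflexive ball_le.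
Proof. by move=> a; rewrite /ball_le qdistxx subrr. Qed.

Lemma ball_le_radius a b : ball_le a b -> (radius b <= radius a)%R.
Proof.
by move=> ab; rewrite -subr_ge0 -lee_fin (le_trans _ ab)// qdist_ge0.
Qed.

Lemma ball_le_anti : antisymmetric ball_le.
Proof.
move=> a b /andP[ab ba].
have rr : radius a = radius b.
  by apply/eqP; rewrite eq_le !ball_le_radius.
case: a b ab ba rr => [x r] [y s]; rewrite /ball_le /center /radius /=.
move=> xy yx rs; rewrite rs subrr in xy yx.
congr (_, _); last exact/val_inj.
by apply: qdist_eq0; apply/eqP; rewrite eq_le qdist_ge0 andbT.
Qed.

Lemma ball_le_trans : transitive ball_le.
Proof.
move=> b a c ab bc; apply: (le_trans (qdist_triangle _ (center b) _)).
apply: (le_trans (leeD ab bc)).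
by rewrite -EFinD lee_fin addrA subrK.
Qed.

HB.instance Definition _ := gen_eqMixin B.
HB.instance Definition _ := gen_choiceMixin B.
HB.instance Definition _ := Order.Le_isPOrder.Build formal_ball_display B
  ball_le_refl ball_le_anti ball_le_trans.

Lemma directed_forward_cauchy (A : set B) :
  directed A -> forward_cauchy A center.
Proof.
move=> [[a0 Aa0] _].
have rA0 : [set radius a | a in A] !=set0 by exists (radius a0), a0.
have rAlb : has_lbound [set radius a | a in A].
  by exists 0%R => _ [a _ <-]; rewrite /radius.
apply/eqP; rewrite eq_le; apply/andP; split; last first.
  apply: le_ereal_inf_tmp => _ [i _ <-].
  by apply: ereal_sup_ubound; left.
apply/lee_addgt0Pr => e e0; rewrite add0e.
have [|_ [i Ai <-] ie] := @inf_adherent _ [set radius a | a in A] e e0.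
  by split.
apply: ge_ereal_inf; exists (nnsup [set qdist (center jk.1) (center jk.2) |
      jk in [set jk : B * B |
        [/\ A jk.1, A jk.2, (i <= jk.1)%O & (jk.1 <= jk.2)%O]]]).
  by exists i.
apply: ge_ereal_sup => _ [->|[[j k] /= [Aj Ak ij jk] <-]].
  by rewrite lee_fin ltW.
have jk' : qdist (center j) (center k) <= (radius j - radius k)%:E := jk.
apply: (le_trans jk'); rewrite lee_fin lerBlDl.
have ij' : (radius j <= radius i)%R := ball_le_radius ij.
apply: (le_trans ij'); apply: (le_trans (ltW ie)); rewrite lerD2r.
by apply: ge_inf => //; exists k.
Qed.

End FormalBall.

(* A directed set of formal balls is its own index set; the net of its centers
   is forward Cauchy by directed_forward_cauchy. *)
Definition standard {R : realType} (X : quasiMetricType R) :=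
  forall A : set (formal_ball X), directed A -> has_join A ->
    exists a : X, yoneda_limit A center a.

(* Main.v *)
Require Import Defs.
From mathcomp Require Import all_boot all_order all_algebra.
From mathcomp Require Import classical_sets reals constructive_ereal.
From mathcomp Require Import boolp interval_inference ereal.

Set Implicit Arguments.
Unset Strict Implicit.
Unset Printing Implicit Defensive.

Import Order.TTheory GRing.Theory Num.Theory.

(** A directed set [A] of formal balls, with infimum [s] of radii, determines
    the weight [ball_weight A], [x |-> inf_i (d(x, x_i) + r_i - s)].  A weight
    [psi] satisfies [psi(x) <= d(x, x_i) + psi(x_i)], so it need only be
    compared with [ball_weight A] at the centers:
      [rho (ball_weight A) psi <= t <-> forall i, psi(x_i) <= r_i - s + t]
    ([rho_ball_weight_leP]).  Moreover [psi(x_i) - r_i] increases with the ball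
    [(x_i, r_i)].  Consequently:
    - [ball_weight A] is an ideal ([ball_weight_ideal]), bounded as soon as [A]
      has an upper bound ([ball_weight_bounded]);
    - its colimits are exactly the Yoneda limits of the centers
      ([yoneda_limit_colimit]);
    - if [b] is such a colimit, the ball [(b, s)] is the join of [A]
      ([colimit_has_join]).
    Hence, when bounded ideals have colimits, a directed set of balls that has
    an upper bound has a join, and its centers have a Yoneda limit.

    Conversely every bounded ideal [phi] is of the form [ball_weight A].  If
    [d(-, a) <= phi + s], take for [A] the strict epigraph of [phi + s].  It is
    directed because [phi] is an ideal ([epigraph_directed]), the ball [(a, 0)]
    bounds it, and its ball weight is [phi] ([ball_weight_epigraph]).  It has a
    join since the balls form a local dcpo, so its centers have a Yoneda limit
    by standardness, and this limit is a colimit of [phi]. *)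

(** * Truncated subtraction and the distance between weights *)

Section Truncation.
Local Open Scope classical_set_scope.
Local Open Scope ereal_scope.
Context {R : realType}.
Implicit Types (a b t : \bar R) (A : set (\bar R)).

Lemma esubn_ge0 a b : 0 <= esubn a b.
Proof. by rewrite /esubn le_max lexx. Qed.

(** Truncated subtraction is left adjoint to addition; with [rho_leP] below,
    this turns every bound on [rho] into pointwise inequalities between sums,
    in which infinite values need no separate treatment. *)
Lemma esubn_le a b t : 0 <= b -> 0 <= t -> (esubn a b <= t) = (a <= b + t).
Proof.
move=> b0 t0; rewrite /esubn ge_max t0 /=.
case: b b0 => [b| |] // b0; last first.
  by case: t t0 => [t| |] // _; rewrite ?addeNy ?leNye ?leey.
by rewrite leeBlDl.
Qed.

Lemma le_add_esubn a b : 0 <= b -> a <= b + esubn a b.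
Proof. by move=> b0; rewrite -esubn_le ?esubn_ge0. Qed.

Lemma nnsup_le A t : 0 <= t -> (forall a, A a -> a <= t) -> nnsup A <= t.
Proof. by move=> t0 At; apply: ge_ereal_sup => a [->//|/At]. Qed.

Lemma nnsup_ub A a : A a -> a <= nnsup A.
Proof. by move=> Aa; apply: ereal_sup_ubound; right. Qed.

Lemma nnsup_ge0 A : 0 <= nnsup A.
Proof. by apply: ereal_sup_ubound; left. Qed.

End Truncation.

Section Weights.
Local Open Scope classical_set_scope.
Local Open Scope ereal_scope.
Context {R : realType} {X : quasiMetricType R}.
Implicit Types (phi psi : X -> \bar R) (a b x y z : X) (t : \bar R).

Lemma rho_ge0 phi psi : 0 <= rho phi psi.
Proof. exact: nnsup_ge0. Qed.

Lemma rho_leP phi psi t : (forall x, 0 <= phi x) -> 0 <= t ->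
  rho phi psi <= t <-> forall x, psi x <= phi x + t.
Proof.
move=> phi0 t0; split=> [rt x|h].
  by rewrite -esubn_le//; apply: le_trans rt; apply: nnsup_ub; exists x.
by apply: nnsup_le => // a [x _ <-]; rewrite esubn_le.
Qed.

Lemma le_add_rho phi psi x : (forall x, 0 <= phi x) ->
  psi x <= phi x + rho phi psi.
Proof.
by move=> phi0; move: x; apply/rho_leP => //; exact: rho_ge0.
Qed.

Lemma yoneda_weight a : weight (yoneda a).
Proof.
by split=> [x|x y]; [exact: qdist_ge0|rewrite addeC; exact: qdist_triangle].
Qed.

(** For finite [u] this is the least weight whose value at [x] is at least [u],
    which makes it the test weight for detecting that [phi x < u]. *)
Lemma esubn_weight (u : \bar R) x : weight (fun z => esubn u (qdist x z)).
Proof.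
split=> [z|z' z]; first exact: esubn_ge0.
rewrite esubn_le ?qdist_ge0 ?adde_ge0 ?qdist_ge0 ?esubn_ge0//.
apply: (le_trans (le_add_esubn u (qdist_ge0 x z))).
by rewrite addeC addeCA; apply/leeD2l/qdist_triangle.
Qed.

(** The ideal condition in elementary form, obtained from the two weights
    [u - d(x, -)] and [v - d(y, -)]: their distances from [phi] are positive, as
    witnessed at [x] and [y], so the distance of their minimum is positive too,
    and [z] is a point that witnesses this. *)
Lemma ideal_meet phi x y (u v : \bar R) : ideal phi ->
  phi x < u -> phi y < v ->
  exists z, qdist x z + phi z < u /\ qdist y z + phi z < v.
Proof.
move=> [[phi0 _] _ phiI] xu yv.
pose test (w : \bar R) c z := esubn w (qdist c z).
have pos w c : phi c < w -> 0 < rho phi (test w c).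
  move=> cw; rewrite ltNge; apply/negP => /rho_leP -/(_ phi0 (lexx _) c).
  by rewrite adde0 /test esubn_le ?qdist_ge0// qdistxx add0e leNgt cw.
have : 0 < rho phi (fun z => mine (test u x z) (test v y z)).
  rewrite phiI ?lt_min ?pos//; exact: esubn_weight.
move=> rho_gt0; apply: contrapT => noz.
move: rho_gt0; rewrite ltNge => /negP; apply; apply/rho_leP => // z.
rewrite adde0 ge_min /test !esubn_le ?qdist_ge0//.
apply: contrapT => /negP; rewrite negb_or -!ltNge => /andP[zu zv].
by apply: noz; exists z.
Qed.

End Weights.

(** * The weight of a directed set of formal balls *)

Section BallWeight.
Local Open Scope classical_set_scope.
Local Open Scope ereal_scope.
Context {R : realType} {X : quasiMetricType R}.
Local Notation B := (formal_ball X).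
Implicit Types (A : set B) (i j k : B) (x y b : X).

Definition inf_radius A : R := inf [set radius i | i in A].

(** For directed [A] this is the ideal of the forward Cauchy net of centers,
    [x |-> inf_i sup_(j >= i) d(x, x_j)]; the radii make the iterated limit a
    plain infimum. *)
Definition ball_weight A x : \bar R :=
  ereal_inf [set qdist x (center i) + (radius i - inf_radius A)%:E | i in A].

Lemma radius_has_inf A : A !=set0 -> has_inf [set radius i | i in A].
Proof.
move=> [i Ai]; split; first by exists (radius i), i.
by exists 0%R => r [j _ <-]; rewrite /radius.
Qed.

Lemma inf_radius_le A i : A i -> (inf_radius A <= radius i)%R.
Proof.
move=> Ai; apply: ge_inf; last by exists i.
by apply: (radius_has_inf _).2; exists i.
Qed.

Lemma inf_radius_ge A (s : R) : A !=set0 ->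
  (forall i, A i -> (s <= radius i)%R) -> (s <= inf_radius A)%R.
Proof.
move=> /radius_has_inf[A0 _] h; apply: lb_le_inf => // r [j Aj <-].
exact: h.
Qed.

Lemma inf_radius_adherent A (e : R) : A !=set0 -> (0 < e)%R ->
  exists2 i, A i & (radius i < inf_radius A + e)%R.
Proof.
by move=> /radius_has_inf A0 /inf_adherent /(_ A0)[r [i Ai <-] ?]; exists i.
Qed.

Lemma ball_weight_ge0 A x : 0 <= ball_weight A x.
Proof.
apply: le_ereal_inf_tmp => r [i Ai <-].
by rewrite adde_ge0 ?qdist_ge0// lee_fin subr_ge0 inf_radius_le.
Qed.

Lemma ball_weight_weight A : weight (ball_weight A).
Proof.
split=> [|x y]; first exact: ball_weight_ge0.
have [dfin|] := boolP (qdist x y \is a fin_num); last first.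
  rewrite ge0_fin_numE ?qdist_ge0// -leNgt leye_eq => /eqP ->.
  by rewrite addey ?leey// gt_eqF// (lt_le_trans _ (ball_weight_ge0 A y)).
rewrite -leeBlDr//; apply: le_ereal_inf_tmp => r [i Ai <-].
rewrite leeBlDr//; apply: ge_ereal_inf.
exists (qdist x (center i) + (radius i - inf_radius A)%:E); first by exists i.
by rewrite addeAC leeD2r// addeC qdist_triangle.
Qed.

Lemma ball_weight_center A i : A i ->
  ball_weight A (center i) <= (radius i - inf_radius A)%:E.
Proof.
move=> Ai; apply: ge_ereal_inf; exists (0 + (radius i - inf_radius A)%:E).
  by exists i; rewrite ?qdistxx.
by rewrite add0e.
Qed.

Lemma rho_ball_weight_center A (psi : X -> \bar R) i : A i ->
  psi (center i) <= (radius i - inf_radius A)%:E + rho (ball_weight A) psi.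
Proof.
move=> Ai; apply: (le_trans (le_add_rho psi (center i) (ball_weight_ge0 A))).
exact/leeD2r/ball_weight_center.
Qed.

Lemma rho_ball_weight_leP A (psi : X -> \bar R) (t : \bar R) :
  weight psi -> 0 <= t ->
  rho (ball_weight A) psi <= t <->
  forall i, A i -> psi (center i) <= (radius i - inf_radius A)%:E + t.
Proof.
move=> [_ psiW] t0; split=> [rt i Ai|h].
  exact: le_trans (rho_ball_weight_center psi Ai) (leeD2l _ rt).
apply/rho_leP => // [|x]; first exact: ball_weight_ge0.
have [tfin|] := boolP (t \is a fin_num); last first.
  rewrite ge0_fin_numE// -leNgt leye_eq => /eqP ->.
  by rewrite addey ?leey// gt_eqF// (lt_le_trans _ (ball_weight_ge0 A x)).
rewrite -leeBlDr//; apply: le_ereal_inf_tmp => r [i Ai <-].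
rewrite leeBlDr//; apply: (le_trans (psiW x (center i))).
by rewrite addeC -addeA leeD2l// h.
Qed.

(** If the minimum of [la] and [mu] is within [t] of the ball weight, while
    neither [la] nor [mu] is, then each fails at some ball of [A].  Failures
    persist at larger balls, so both fail at a common upper bound. *)
Lemma ball_weight_ideal A : directed A -> ideal (ball_weight A).
Proof.
move=> [A0 Adir]; split; first exact: ball_weight_weight.
  apply/eqP; rewrite eq_le; apply/andP; split; last first.
    by apply: le_ereal_inf_tmp => r [x _ <-]; exact: ball_weight_ge0.
  apply/lee_addgt0Pr => e e0; rewrite add0e.
  have [i Ai ie] := inf_radius_adherent A0 e0.
  apply: ge_ereal_inf; exists (ball_weight A (center i)).
    by exists (center i).
  by apply: le_trans (ball_weight_center Ai) _; rewrite lee_fin lerBlDl ltW.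
move=> la mu laW muW.
have rho_mono psi psi' : (forall x, psi x <= psi' x) ->
    rho (ball_weight A) psi <= rho (ball_weight A) psi'.
  move=> le_psi; apply/rho_leP => [x||x].
  - exact: ball_weight_ge0.
  - exact: rho_ge0.
  - exact: le_trans (le_psi x) (le_add_rho _ _ (ball_weight_ge0 A)).
apply/eqP; rewrite eq_le; apply/andP; split.
  by rewrite le_min !rho_mono// => x; rewrite ge_min lexx ?orbT.
set t := (X in _ <= X).
have t0 : 0 <= t by exact: rho_ge0.
have fail psi : weight psi -> ~ rho (ball_weight A) psi <= t ->
    exists2 i, A i & forall j, A j -> (i <= j)%O ->
      (radius j - inf_radius A)%:E + t < psi (center j).
  move=> psiW /(rho_ball_weight_leP A psiW t0)/existsNP[i /not_implyP[Ai]].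
  move=> /negP; rewrite -ltNge => i_fails; exists i => // j Aj ij.
  have ij' : qdist (center i) (center j) <= (radius i - radius j)%:E := ij.
  have := lt_le_trans i_fails (le_trans (psiW.2 _ (center j)) (leeD2l _ ij')).
  rewrite -lteBlDr// => /(le_lt_trans _); apply.
  by rewrite addeAC leeD2r// lee_fin opprB addrC subrKA.
apply: contrapT => /negP; rewrite ge_min negb_or => /andP[/negP tla /negP tmu].
have [i Ai ifail] := fail _ laW tla; have [j Aj jfail] := fail _ muW tmu.
have [k Ak [ik jk]] := Adir _ _ Ai Aj.
have := rho_ball_weight_center (fun x => mine (la x) (mu x)) Ak.
by rewrite -/t leNgt lt_min ifail// jfail.
Qed.

Lemma ball_weight_bounded A : directed A -> has_ubound A ->
  bounded_ideal (ball_weight A).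
Proof.
move=> dA [c cub]; split; last exact: ball_weight_ideal.
split; first exact: ball_weight_weight.
have cA : (radius c <= inf_radius A)%R.
  by apply: inf_radius_ge dA.1 _ => i /cub; exact: ball_le_radius.
apply: (@le_lt_trans _ _ (inf_radius A - radius c)%:E); last exact: ltry.
apply: ge_ereal_inf; exists (rho (ball_weight A) (yoneda (center c))).
  by exists (center c).
apply/rho_ball_weight_leP; first exact: yoneda_weight.
  by rewrite lee_fin subr_ge0.
by move=> i Ai; rewrite -EFinD subrKA; exact: cub Ai.
Qed.

(** Along [A] the distances [d(x_j, y)] need not be monotone, but
    [d(x_j, y) - r_j] is; the radii of the balls beyond [i] vary by less than
    any given [e] once [i] is large, so the iterated limit of the distances
    reduces to the supremum of [d(x_j, y) - (r_j - s)]. *)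
Lemma rho_ball_weight_yoneda A y : directed A ->
  rho (ball_weight A) (yoneda y) =
  ereal_inf [set nnsup [set qdist (center j) y |
    j in [set j | A j /\ (i <= j)%O]] | i in A].
Proof.
move=> [A0 Adir]; apply/eqP; rewrite eq_le; apply/andP; split.
  apply: le_ereal_inf_tmp => r [k Ak <-].
  apply/rho_ball_weight_leP => [||i Ai].
  - exact: yoneda_weight.
  - exact: nnsup_ge0.
  have [j Aj [ij kj]] := Adir _ _ Ai Ak.
  apply: (le_trans (qdist_triangle _ (center j) _)).
  apply: leeD; last by apply: nnsup_ub; exists j.
  have ij' : qdist (center i) (center j) <= (radius i - radius j)%:E := ij.
  by apply: le_trans ij' _; rewrite lee_fin lerB// inf_radius_le.
apply/lee_addgt0Pr => e e0.
have [i Ai ie] := inf_radius_adherent A0 e0.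
apply: ge_ereal_inf; eexists; first by exists i.
apply: nnsup_le => [|r [j [Aj ij] <-]].
  by rewrite adde_ge0 ?rho_ge0// lee_fin ltW.
apply: le_trans (rho_ball_weight_center (yoneda y) Aj) _.
rewrite addeC leeD2l// lee_fin lerBlDl.
exact: le_trans (ball_le_radius ij) (ltW ie).
Qed.

Lemma yoneda_limit_colimit A b : directed A ->
  yoneda_limit A center b <-> colimit (ball_weight A) b.
Proof.
by move=> dA; split=> h y; rewrite h rho_ball_weight_yoneda.
Qed.

(** Being above all of [A] means, for a ball [(y, s')], that [y] is within
    [inf_radius A - s'] of the ball weight, and for a colimit [b] this is
    [d(b, y) <= inf_radius A - s']. *)
Lemma colimit_has_join A b : directed A -> colimit (ball_weight A) b ->
  has_join A.
Proof.
move=> [A0 _] bcolim.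
have s0 : (0 <= inf_radius A)%R.
  by apply: inf_radius_ge => // i _; rewrite /radius.
exists ((b, NngNum s0) : B); split=> [i Ai|c cub].
  rewrite /Order.le /= /ball_le /=.
  have := rho_ball_weight_center (yoneda b) Ai.
  by rewrite -bcolim qdistxx adde0.
rewrite /Order.le /= /ball_le /= bcolim.
apply/rho_ball_weight_leP => [||i Ai]; first exact: yoneda_weight.
  rewrite lee_fin subr_ge0; apply: inf_radius_ge => // i /cub.
  exact: ball_le_radius.
by rewrite -EFinD subrKA; exact: cub Ai.
Qed.

End BallWeight.

(** * The directed set of formal balls of a bounded ideal *)

Section Epigraph.
Local Open Scope classical_set_scope.
Local Open Scope ereal_scope.
Context {R : realType} {X : quasiMetricType R}.
Local Notation B := (formal_ball X).
Implicit Types (phi : X -> \bar R) (s : R) (x y z a : X).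

(** The shift by [s] leaves room for an upper bound, since radii cannot be
    negative. *)
Definition epigraph phi s : set B :=
  [set i | phi (center i) + s%:E < (radius i)%:E].

Lemma epigraph_ball phi s x r : (forall x, 0 <= phi x) -> (0 <= s)%R ->
  phi x + s%:E < r%:E ->
  exists i : B, [/\ epigraph phi s i, center i = x & radius i = r].
Proof.
move=> phi0 s0 xr.
have r0 : (0 <= r)%R.
  by rewrite -lee_fin ltW// (le_lt_trans _ xr)// adde_ge0.
by exists (x, NngNum r0).
Qed.

Lemma epigraph_near phi s e : ideal phi -> (0 <= s)%R -> (0 < e)%R ->
  exists2 i, epigraph phi s i & radius i = (s + e)%R.
Proof.
move=> [[phi0 _] phiinf _] s0 e0.
have [|r [x _ <-] xe] := @ereal_inf_lt _ (range phi) e%:E.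
  by rewrite phiinf lte_fin.
have [|i [? _ ?]] := @epigraph_ball phi s x (s + e) phi0 s0.
  by rewrite addeC EFinD lteD2lE.
by exists i.
Qed.

Lemma epigraph_directed phi s : ideal phi -> (0 <= s)%R ->
  directed (epigraph phi s).
Proof.
move=> phiI s0; split.
  by have [i] := epigraph_near phiI s0 ltr01; exists i.
move=> i j Ai Aj; have [[phi0 _] _ _] := phiI.
have [||z []] := ideal_meet phiI (x := center i) (y := center j)
  (u := (radius i - s)%:E) (v := (radius j - s)%:E).
- by rewrite EFinB lteBrDr.
- by rewrite EFinB lteBrDr.
move: (phi0 z) (qdist_ge0 (center i) z) (qdist_ge0 (center j) z).
case phiz : (phi z) => [p| |] //; last first.
  by rewrite addey// gt_eqF// (lt_le_trans _ (qdist_ge0 _ _)).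
case iz : (qdist (center i) z) => [d| |] //.
case jz : (qdist (center j) z) => [d'| |] //.
rewrite -!EFinD !lte_fin => _ _ _ di dj.
(* The largest radius for which a ball at [z] is above both [i] and [j]. *)
pose r := Num.min (radius i - d)%R (radius j - d')%R.
have [|k [Ak kz kr]] := @epigraph_ball phi s z r phi0 s0.
  rewrite phiz -EFinD lte_fin lt_min; apply/andP.
  by split; rewrite ltrBrDl addrA -ltrBrDr.
exists k => //; split; rewrite /Order.le /= /ball_le kz kr ?iz ?jz.
  by rewrite lee_fin lerBrDl -lerBrDr ge_min lexx.
by rewrite lee_fin lerBrDl -lerBrDr ge_min lexx orbT.
Qed.

Lemma inf_radius_epigraph phi s : ideal phi -> (0 <= s)%R ->
  inf_radius (epigraph phi s) = s.
Proof.
move=> phiI s0; have [[phi0 _] _ _] := phiI.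
have [A0 _] := epigraph_directed phiI s0.
apply/eqP; rewrite eq_le; apply/andP; split.
  apply/ler_addgt0Pr => e e0.
  by have [i Ai <-] := epigraph_near phiI s0 e0; exact: inf_radius_le.
apply: inf_radius_ge => // i Ai.
by rewrite -lee_fin (le_trans _ (ltW Ai))// leeDr.
Qed.

Lemma ball_weight_epigraph phi s : ideal phi -> (0 <= s)%R ->
  ball_weight (epigraph phi s) = phi.
Proof.
move=> phiI s0; have [[phi0 phiW] _ _] := phiI.
apply/funext => x; rewrite /ball_weight inf_radius_epigraph//.
apply/eqP; rewrite eq_le; apply/andP; split; last first.
  apply: le_ereal_inf_tmp => r [i Ai <-].
  apply: (le_trans (phiW x (center i))).
  by rewrite addeC leeD2l// EFinB leeBrDr// ltW.
case phix : (phi x) (phi0 x) => [p| |] // _; last by rewrite leey.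
apply/lee_addgt0Pr => e e0.
have [|i [Ai ix ir]] := @epigraph_ball phi s x (p + s + e) phi0 s0.
  by rewrite phix -EFinD lte_fin ltrDl.
apply: ge_ereal_inf; eexists; first by exists i.
by rewrite ix ir qdistxx add0e -EFinD lee_fin addrAC addrK.
Qed.

Lemma epigraph_ubound phi s a : ideal phi -> rho phi (yoneda a) <= s%:E ->
  has_ubound (epigraph phi s).
Proof.
move=> [[phi0 _] _ _] ra.
exists ((a, NngNum (lexx (0%R : R))) : B) => i Ai.
rewrite /Order.le /= /ball_le /= subr0.
apply: (le_trans (le_add_rho (yoneda a) (center i) phi0)).
by apply: le_trans (ltW Ai); rewrite leeD2l.
Qed.

End Epigraph.

Theorem theorem4p5 (R : realType) (X : quasiMetricType R) :
  J_algebra X <-> standard X /\ local_dcpo (formal_ball X).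
Proof.
split=> [alg|[std dcpo] phi [[_ phib] phiI]].
  have Acolim A : directed A -> has_ubound A ->
      exists b : X, colimit (ball_weight A) b.
    by move=> dA Aub; apply: alg; exact: ball_weight_bounded.
  split=> [A dA [c [cub _]]|A dA Aub].
    have [|b bcolim] := Acolim A dA; first by exists c.
    by exists b; apply/yoneda_limit_colimit.
  by have [b bcolim] := Acolim A dA Aub; exact: colimit_has_join bcolim.
have [r [a _ <-] rfin] := ereal_inf_lt phib.
have r0 := rho_ge0 phi (yoneda a).
have [s rs] : exists s, rho phi (yoneda a) = s%:E.
  by exists (fine (rho phi (yoneda a))); rewrite fineK// ge0_fin_numE.
have s0 : (0 <= s)%R by rewrite -lee_fin -rs.
have dA := epigraph_directed phiI s0.
have [|b /(yoneda_limit_colimit _ dA)] := std _ dA.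
  by apply: dcpo => //; apply: (epigraph_ubound (a := a)); rewrite ?rs.
by rewrite ball_weight_epigraph//; exists b.
Qed.
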